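(* Let $q\in L^1_{\mathrm{loc}}(\mathbb R)$, $z_1\in\mathbb C\setminus\mathbb R$, and let $\Psi(z_1,\cdot)=(\psi_1,\psi_2)^\top$ be a $z_1$-wave function associated with $q$ satisfying $\int_{\mathbb R}\|\Psi(z_1,x)\|_{\mathbb C^2}^{-2}dx<\infty$. Let $q^{(1)}_{z_1}=q+4\,\mathrm{Im}(z_1)\psi_1\overline{\psi_2}\|\Psi(z_1,\cdot)\|_{\mathbb C^2}^{-2}$. Then $z_1$ and $\overline{z_1}$ are eigenvalues of $D(q^{(1)}_{z_1})$ of geometric multiplicity one, with eigenfunctions $$\Phi^{(1)}(z_1,x)=\mathrm{Im}(z_1)\|\Psi(z_1,x)\|_{\mathbb C^2}^{-2}\mathcal K\Psi(z_1,x),\qquad \mathcal K\Phi^{(1)}(z_1,x)=-\mathrm{Im}(z_1)\|\Psi(z_1,x)\|_{\mathbb C^2}^{-2}\Psi(z_1,x),$$ i.e. both belong to $\mathrm{dom}(D(q^{(1)}_{z_1}))$ and $D(q^{(1)}_{z_1})\Phi^{(1)}(z_1)=z_1\Phi^{(1)}(z_1)$, $D(q^{(1)}_{z_1})\mathcal K\Phi^{(1)}(z_1)=\overline{z_1}\mathcal K\Phi^{(1)}(z_1)$.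
   Context: Let $q\in L^1_{\mathrm{loc}}(\mathbb R)$. For $z\in\mathbb C$, a $z$-wave function associated with $q$ is a function $\Psi(z,\cdot)=(\psi_1(z,\cdot),\psi_2(z,\cdot))^\top\in AC_{\mathrm{loc}}(\mathbb R)^2$, not identically zero, with $\psi_1'=-iz\psi_1+q\psi_2$, $\psi_2'=iz\psi_2-\overline{q}\psi_1$ a.e.; equivalently $M(q)\Psi=z\Psi$ with $M(q)=i\begin{pmatrix}\frac{d}{dx}&-q\\-\overline q&-\frac{d}{dx}\end{pmatrix}$. For $r\in L^1_{\mathrm{loc}}(\mathbb R)$, $D(r)$ is the maximal operator $F\mapsto M(r)F$ in $L^2(\mathbb R)^2$ on $\{F\in L^2(\mathbb R)^2\cap AC_{\mathrm{loc}}(\mathbb R)^2: M(r)F\in L^2(\mathbb R)^2\}$. $\mathcal K(a,b)^\top=(\overline b,-\overline a)^\top$ pointwise. A wave function never vanishes, so $q^{(1)}_{z_1}$ is well defined and in $L^1_{\mathrm{loc}}(\mathbb R)$. *)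

(* Defs.v *)
From HB Require Import structures.
From mathcomp Require Import all_boot all_order all_algebra.
From mathcomp Require Import all_classical all_reals all_analysis.
From mathcomp Require Import complex.
Set Implicit Arguments. Unset Strict Implicit. Unset Printing Implicit Defensive.
Import Order.TTheory GRing.Theory Num.Theory.
Local Open Scope classical_set_scope.
Local Open Scope ring_scope.

Definition cRe {R : realType} (z : R[i]) : R := complex.Re z.
Definition cIm {R : realType} (z : R[i]) : R := complex.Im z.

Section Defs.
Context {R : realType}.
Local Notation C := (R[i]).
Local Notation mu := (@lebesgue_measure R).

Definition vec := (C * C)%type.

Definition vscale (c : C) (v : vec) : vec := (c * v.1, c * v.2).

Definition nsq (v : vec) : R :=
  (cRe v.1) ^+ 2 + (cIm v.1) ^+ 2 + (cRe v.2) ^+ 2 + (cIm v.2) ^+ 2.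

Definition Kv (v : vec) : vec := (conjc v.2, - conjc v.1).

Definition abs_cont_on (f : R -> R) (a b : R) : Prop :=
  forall e : R, 0 < e -> exists2 d : R, 0 < d &
    forall (n : nat) (s t : nat -> R),
      (forall i, (i < n)%N -> [/\ a <= s i, s i <= t i & t i <= b]) ->
      (forall i j, (i < n)%N -> (j < n)%N -> i <> j -> t i <= s j \/ t j <= s i) ->
      \sum_(i < n) (t i - s i) < d ->
      \sum_(i < n) `|f (t i) - f (s i)| < e.

Definition AC_loc_R (f : R -> R) : Prop := forall a b, a <= b -> abs_cont_on f a b.
Definition AC_loc_C (f : R -> C) : Prop :=
  AC_loc_R (fun x => cRe (f x)) /\ AC_loc_R (fun x => cIm (f x)).
Definition AC_loc_v (F : R -> vec) : Prop :=
  AC_loc_C (fun x => (F x).1) /\ AC_loc_C (fun x => (F x).2).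

Definition L1loc_C (f : R -> C) : Prop :=
  locally_integrable setT (fun x => cRe (f x)) /\
  locally_integrable setT (fun x => cIm (f x)).

Definition has_deriv_ae (f g : R -> C) : Prop :=
  {ae mu, forall x, is_derive x (1 : R) (fun y => cRe (f y)) (cRe (g x)) /\
                    is_derive x (1 : R) (fun y => cIm (f y)) (cIm (g x))}.

Definition L2_C (f : R -> C) : Prop :=
  [/\ measurable_fun setT (fun x => cRe (f x)),
      measurable_fun setT (fun x => cIm (f x)) &
      (\int[mu]_x (((cRe (f x)) ^+ 2 + (cIm (f x)) ^+ 2)%:E) < +oo)%E].
Definition L2v (F : R -> vec) : Prop :=
  L2_C (fun x => (F x).1) /\ L2_C (fun x => (F x).2).

(* M(r) F = G  (a.e.), for F in AC_loc:
   M(r) = i [[d/dx, -r], [-conj r, -d/dx]] *)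
Definition Mrel (r : R -> C) (F G : R -> vec) : Prop :=
  AC_loc_v F /\
  exists d1 d2 : R -> C,
    [/\ has_deriv_ae (fun x => (F x).1) d1,
        has_deriv_ae (fun x => (F x).2) d2 &
        {ae mu, forall x, G x =
           ('i%C * (d1 x - r x * (F x).2),
            'i%C * (- conjc (r x) * (F x).1 - d2 x))}].

Definition domD (r : R -> C) (F : R -> vec) : Prop :=
  [/\ L2v F, AC_loc_v F & exists G, L2v G /\ Mrel r F G].

Definition simple_eigen (r : R -> C) (z : C) (F : R -> vec) : Prop :=
  [/\ domD r F,
      Mrel r F (fun x => vscale z (F x)),
      ~ {ae mu, forall x, F x = (0, 0)} &
      forall G, domD r G -> Mrel r G (fun x => vscale z (G x)) ->
        exists c : C, {ae mu, forall x, G x = vscale c (F x)}].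

Definition wave_function (q : R -> C) (z : C) (Psi : R -> vec) : Prop :=
  [/\ AC_loc_v Psi,
      exists x, Psi x <> (0, 0),
      has_deriv_ae (fun x => (Psi x).1)
        (fun x => - 'i%C * z * (Psi x).1 + q x * (Psi x).2) &
      has_deriv_ae (fun x => (Psi x).2)
        (fun x => 'i%C * z * (Psi x).2 - conjc (q x) * (Psi x).1)].

Definition q1 (q : R -> C) (z1 : C) (Psi : R -> vec) (x : R) : C :=
  q x + ((4 * cIm z1 / nsq (Psi x))%:C)%C * ((Psi x).1 * conjc (Psi x).2).

Definition Phi1 (z1 : C) (Psi : R -> vec) (x : R) : vec :=
  vscale ((cIm z1 / nsq (Psi x))%:C)%C (Kv (Psi x)).

End Defs.

(* Main.v *)
(* For a solution F of M(r)F = zF the potential drops out of the derivative of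
   N = ||F||^2: N' = 2 Im z (|F_1|^2 - |F_2|^2), so |N'| <= 2 |Im z| N and a
   Gronwall argument shows that F vanishes nowhere or everywhere.  Writing
   Phi = (b / N) K Psi with b = Im z_1, this formula for N' turns M(q)Psi = z_1 Psi
   into M(q1)Phi = z_1 Phi, and ||Phi||^2 = b^2 / N is integrable by hypothesis.
   Two L^2 solutions for the same z have a constant, integrable, hence zero
   Wronskian; so they are proportional at one point, and then everywhere by
   uniqueness.  All of this rests on the fact that an absolutely continuous
   function with a.e. nonnegative derivative is nondecreasing. *)
Require Import Defs.
From HB Require Import structures.
From mathcomp Require Import all_boot all_order all_algebra.
From mathcomp Require Import all_classical all_reals all_analysis measurable_realfun.
From mathcomp Require Import complex.
From mathcomp Require Import ring lra.
Set Implicit Arguments.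
Unset Strict Implicit.
Import Order.TTheory GRing.Theory Num.Theory.
Import numFieldNormedType.Exports.
Local Open Scope classical_set_scope.
Local Open Scope ring_scope.

(** * Absolutely continuous functions *)
Section AbsolutelyContinuous.
Context {R : realType}.
Implicit Types f g h : R -> R.

(** The closure rules below all reduce to this: each bounds the increments of the new function by
    those of functions already treated. Two dominating functions are allowed so that sums and
    products fit. *)
Lemma abs_cont_on_dominated f g h (a b M : R) :
  abs_cont_on f a b -> abs_cont_on g a b ->
  (forall s t, a <= s -> s <= t -> t <= b ->
    `|h t - h s| <= M * (`|f t - f s| + `|g t - g s|)) ->
  abs_cont_on h a b.
Proof.
(* The sign of [M] is unknown; [K] is a positive replacement, and [e / (2 * K)] leaves half of the
   error to each of [f] and [g]. *)
move=> fac gac hM e e0; set K := Num.max M 1.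
have K0 : 0 < K by rewrite lt_max ltr01 orbT.
have eK : 0 < e / (2 * K) by rewrite divr_gt0// mulr_gt0.
have [d1 d10 fd] := fac _ eK; have [d2 d20 gd] := gac _ eK.
exists (Num.min d1 d2); first by rewrite lt_min d10.
move=> n s t st disj; rewrite lt_min => /andP[lt1 lt2].
have {}fd := fd _ _ _ st disj lt1; have {}gd := gd _ _ _ st disj lt2.
apply: (@le_lt_trans _ _ (\sum_(i < n) K * (`|f (t i) - f (s i)| + `|g (t i) - g (s i)|))).
  apply: ler_sum => i _; have [as_ st_ tb] := st i (ltn_ord i).
  apply: le_trans (hM _ _ as_ st_ tb) _.
  by rewrite ler_wpM2r ?addr_ge0// le_max lexx.
rewrite -mulr_sumr big_split/= -ltr_pdivlMl//.
have -> : K^-1 * e = e / (2 * K) + e / (2 * K) by field; rewrite gt_eqF.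
exact: ltrD.
Qed.

Lemma abs_cont_on_id (a b : R) : abs_cont_on id a b.
Proof.
move=> e e0; exists e => // n s t st _; congr (_ < _).
apply: eq_bigr => i _.
by have [_ ? _] := st i (ltn_ord i); rewrite ger0_norm ?subr_ge0.
Qed.

Lemma AC_loc_continuous f : AC_loc_R f -> continuous f.
Proof.
move=> fac x; apply/cvgrPdist_lt => e e0.
have [|d d0 fd] := fac (x - 1) (x + 1) _ _ e0; first by lra.
near=> y.
have xy1 : `|x - y| < 1 by near: y; exact: (near_ball x _ ltr01).
have xyd : `|x - y| < d by near: y; exact: (near_ball x _ d0).
move: xy1 xyd => /ltr_normlP[? ?] /ltr_normlP[? ?].
have [xy|yx] := leP x y.
  (* Continuity is the case of a family with a single interval. *)
  have := fd 1%N (fun=> x) (fun=> y); rewrite !big_ord1 distrC; apply => //.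
  - by move=> _ _; split; lra.
  - by move=> [|//] [|].
  - lra.
have := fd 1%N (fun=> y) (fun=> x); rewrite !big_ord1; apply => //.
- by move=> _ _; split; lra.
by move=> [|//] [|].
Unshelve. all: by end_near. Qed.

Lemma continuous_itv_bounded f (a b : R) : continuous f ->
  exists M, forall x, a <= x -> x <= b -> `|f x| <= M.
Proof.
move=> fc.
have [|N [_ Nf]] := @compact_bounded _ R^o (f @` `[a, b]).
  apply: continuous_compact; last exact: segment_compact.
  exact: continuous_subspaceT.
exists (N + 1) => x ax xb; apply: Nf; first by rewrite ltrDl.
by exists x => //=; rewrite in_itv/= ax xb.
Qed.

Lemma AC_loc_locally_lipschitz h :
  (forall a b, exists M, forall s t, a <= s -> s <= t -> t <= b ->
    `|h t - h s| <= M * (t - s)) -> AC_loc_R h.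
Proof.
move=> hM a b _; have [M {}hM] := hM a b.
apply: (@abs_cont_on_dominated id id _ _ _ (M / 2)); [exact: abs_cont_on_id..|].
move=> s t as_ st tb; apply: le_trans (hM _ _ as_ st tb) _.
by rewrite /= ger0_norm ?subr_ge0//; lra.
Qed.

(** * Elementary functions and algebraic operations *)

Lemma AC_loc_cst (c : R) : AC_loc_R (fun=> c).
Proof.
apply: AC_loc_locally_lipschitz => a b; exists 0 => s t _ _ _.
by rewrite subrr normr0 mul0r.
Qed.

(** The integrating factor of the Gronwall estimate. Its local Lipschitz bound comes from
    [1 + x <= expR x], which gives e^v - e^u <= e^v |v - u|, and from the boundedness of the
    exponential on a compact interval. *)
Lemma AC_loc_expR (k : R) : AC_loc_R (fun x => expR (k * x)).
Proof.
apply: AC_loc_locally_lipschitz => a b.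
have [|M hM] := @continuous_itv_bounded (fun x => expR (k * x)) a b.
  move=> x; apply: continuous_comp; last exact: continuous_expR.
  exact: mulrl_continuous.
exists (M * `|k|) => s t as_ st tb.
have le_exp (u v : R) : expR v - expR u <= expR v * `|v - u|.
  have -> : expR v - expR u = expR v * (1 - expR (u - v)).
    by rewrite mulrBr mulr1 -expRD; congr (_ - expR _); ring.
  rewrite ler_pM2l ?expR_gt0//; have := expR_ge1Dx (u - v).
  by have := ler_norm (v - u); lra.
have ? := hM s as_ (le_trans st tb); have ? := hM t (le_trans as_ st) tb.
have kE (u v : R) : `|k * v - k * u| = `|k| * `|v - u| by rewrite -mulrBr normrM.
have ts : `|t - s| = t - s by rewrite ger0_norm ?subr_ge0.
have M_ge x : `|expR (k * x)| <= M ->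
    expR (k * x) * (`|k| * (t - s)) <= M * `|k| * (t - s).
  move=> /(le_trans (ler_norm _)) xM; rewrite mulrA ler_wpM2r ?subr_ge0//.
  by rewrite ler_wpM2r.
rewrite ler_norml; apply/andP; split.
  rewrite lerNl opprB; apply: le_trans (le_exp _ _) _.
  by rewrite kE (distrC s) ts M_ge.
by apply: le_trans (le_exp _ _) _; rewrite kE ts M_ge.
Qed.

Lemma AC_locD f g : AC_loc_R f -> AC_loc_R g -> AC_loc_R (fun x => f x + g x).
Proof.
move=> fac gac a b ab; apply: (@abs_cont_on_dominated f g _ _ _ 1); [exact: fac|exact: gac|].
move=> s t _ _ _; rewrite mul1r.
have -> : f t + g t - (f s + g s) = (f t - f s) + (g t - g s) by ring.
exact: ler_normD.
Qed.

Lemma AC_locM f g : AC_loc_R f -> AC_loc_R g -> AC_loc_R (fun x => f x * g x).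
Proof.
move=> fac gac a b ab.
have [M1 fM] := @continuous_itv_bounded f a b (AC_loc_continuous fac).
have [M2 gM] := @continuous_itv_bounded g a b (AC_loc_continuous gac).
apply: (@abs_cont_on_dominated f g _ _ _ (Num.max M1 M2)); [exact: fac|exact: gac|].
move=> s t as_ st tb.
have -> : f t * g t - f s * g s = (f t - f s) * g t + f s * (g t - g s) by ring.
apply: le_trans (ler_normD _ _) _; rewrite !normrM mulrDr lerD//.
  by rewrite mulrC ler_wpM2r// le_max gM ?orbT// (le_trans as_).
by rewrite ler_wpM2r// le_max fM// (le_trans st).
Qed.

Lemma AC_locN f : AC_loc_R f -> AC_loc_R (fun x => - f x).
Proof.
move=> fac; have := AC_locM (AC_loc_cst (-1)) fac.
by congr AC_loc_R; apply/funext => x; rewrite mulN1r.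
Qed.

(** By continuity 1/f is bounded by some [M] on [a, b], and an increment of 1/f is that of [f]
    divided by -f(s)f(t), hence at most [M * M] times as large. *)
Lemma AC_locV f : (forall x, f x != 0) -> AC_loc_R f -> AC_loc_R (fun x => (f x)^-1).
Proof.
move=> f0 fac a b ab.
have [|M fM] := @continuous_itv_bounded (fun x => (f x)^-1) a b.
  by move=> x; apply: cvgV => //; exact: AC_loc_continuous.
apply: (@abs_cont_on_dominated f f _ _ _ (M * M)); [exact: fac..|].
move=> s t as_ st tb.
have ft := f0 t; have fs := f0 s.
have -> : (f t)^-1 - (f s)^-1 = - ((f t)^-1 * (f s)^-1 * (f t - f s)).
  by field; apply/andP.
rewrite normrN !normrM ler_pM ?mulr_ge0 ?lerDl//.
by rewrite ler_pM// fM// ?(le_trans as_) ?(le_trans st).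
Qed.

End AbsolutelyContinuous.

(** * Monotonicity from the sign of the derivative *)
Section Monotonicity.
Context {R : realType}.
Implicit Types f : R -> R.
Local Notation mu := (@lebesgue_measure R).

Global Instance lebesgue_ae_filter : Filter (nbhs (almost_everywhere mu)) :=
  ae_filter_ringOfSetsType mu.

(* Cousin's lemma, in the form of an induction on intervals. *)
Lemma cousin (P : R -> R -> Prop) (a b : R) : a <= b ->
  (forall r s t, r <= s -> s <= t -> P r s -> P s t -> P r t) ->
  (forall x, exists2 d, 0 < d &
    forall s t, x - d < s -> s <= x -> x <= t -> t < x + d -> P s t) ->
  P a b.
Proof.
(* [A] collects the endpoints reachable from [a]; its supremum [c] is shown to be reachable and
   equal to [b]. *)
move=> ab Pcat Ploc; pose A := [set t | [/\ a <= t, t <= b & P a t]].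
have Aa : A a by split => //; have [d d0] := Ploc a; apply => //; lra.
have Ab : ubound A b by move=> t [].
have Asup : has_sup A by split; [exists a|exists b].
set c := sup A.
have ac : a <= c by apply: ub_le_sup => //; exists b.
have cb : c <= b by apply: ge_sup => //; exists a.
have [d d0 Pd] := Ploc c.
have [t [at_ tb Pat] ct] := sup_adherent d0 Asup.
have tc : t <= c by apply: ub_le_sup; [exists b|].
have Pac : P a c by apply: (Pcat _ t) => //; apply: Pd => //; rewrite ltrDl.
have [bc|{}cb] := leP b c; first by rewrite (le_anti (introT andP (conj bc cb))) in Pac *.
(* If c < b, the local hypothesis at [c] reaches a point [u] beyond [c], against the choice of
   [c]. *)
have [u [cu ud ub]] : exists u, [/\ c < u, u < c + d & u <= b].
  have [?|?] := leP b (c + d / 2); first by exists b; split => //; lra.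
  by exists (c + d / 2); split; lra.
suff : u <= c by rewrite leNgt cu.
apply: ub_le_sup; first by exists b.
split; [lra|lra|apply: (Pcat _ c) => //; first exact: ltW].
by apply: Pd => //; [lra|exact: ltW].
Qed.

(** Near [x] the difference quotients exceed -k on either side; the bounds on [s, x] and [x, t] add
    up. *)
Lemma derive_ge0_local f (x df k : R) : is_derive x 1 f df -> 0 <= df -> 0 < k ->
  exists2 d, 0 < d &
    forall s t, x - d < s -> s <= x -> x <= t -> t < x + d ->
      f s - f t <= k * (t - s).
Proof.
move=> fx df0 k0.
have : h^-1 *: ((f \o shift x) (h *: (1 : R)) - f x) @[h --> 0^'] --> df.
  by rewrite -(@derive_val _ _ _ _ _ _ _ fx); exact: (@ex_derive _ _ _ _ _ _ _ fx).
move=> /cvgrPdist_lt /(_ _ k0) /nbhs_ballP [d /= d0 dP].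
have {}dP h : `|h| < d -> h != 0 -> - k <= (f (h + x) - f x) / h.
  move=> hd h0; have := dP h; rewrite /ball/= sub0r normrN => /(_ hd h0).
  rewrite /shift/= -[h *: 1]/(h * 1) mulr1 -[_ *: _]/(_ * _) mulrC.
  by rewrite ltr_norml => /andP[_]; lra.
exists d => // s t xds sx xt txd.
have f_le_r : f x - f t <= k * (t - x).
  have [->|tx] := eqVneq t x; first by rewrite !subrr mulr0.
  have h0 : 0 < t - x by lra.
  have hd : `|t - x| < d by rewrite gtr0_norm//; lra.
  by have := dP _ hd (lt0r_neq0 h0); rewrite subrK ler_pdivlMr//; lra.
have f_le_l : f s - f x <= k * (x - s).
  have [->|sx'] := eqVneq s x; first by rewrite !subrr mulr0.
  have h0 : s - x < 0 by lra.
  have hd : `|s - x| < d by rewrite ltr0_norm//; lra.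
  by have := dP _ hd (ltr0_neq0 h0); rewrite subrK ler_ndivlMr//; lra.
lra.
Qed.

(** The possible decrease of [f] on [a, b] is split in two. Around exceptional points, intervals lie
    in an open set of small measure, where absolute continuity bounds the variation by e/2; around
    other points the derivative bounds the decrease by a small slope. Cousin's lemma glues the local
    estimates. *)
Lemma AC_loc_nondecreasing f : AC_loc_R f ->
  {ae mu, forall x, exists2 df : R, 0 <= df & is_derive x (1 : R) f df} ->
  forall a b, a <= b -> f a <= f b.
Proof.
move=> fac [B [mB B0 fB]] a b ab; apply/ler_addgt0Pr => e e0.
have e20 : 0 < e / 2 by exact: divr_gt0.
have [d d0 fd] := fac a b ab _ e20.
(* Outer regularity encloses the null set [B] in an open set whose measure is below the threshold
   [d] of absolute continuity. *)
have [U [oU BU UB]] : exists U : set R, [/\ open U, B `<=` U & (mu (U `\` B) < d%:E)%E].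
  by apply: lebesgue_regularity_outer => //; rewrite [X in (X < _)%E]B0.
have mU : measurable U by exact: open_measurable.
have Ud : (mu U < d%:E)%E.
  rewrite -(setDUK BU); apply: le_lt_trans (measureU2 _ _ _) _ => //.
    exact: measurableD.
  by rewrite [X in (X + _)%E]B0 add0e.
(* With this slope the total loss k(b - a) is at most e/2; the added 1 covers a = b. *)
set k := e / 2 / (b - a + 1).
have k0 : 0 < k by rewrite !divr_gt0//; lra.
(* The subintervals [S i, T i] cover the tags lying in the exceptional open
   set U; away from it the local estimate has slope k. *)
pose P s t := exists n (S T : nat -> R),
  [/\ forall i, (i < n)%N -> [/\ s <= S i, S i <= T i & T i <= t],
      forall i j, (i < n)%N -> (j < n)%N -> i <> j -> T i <= S j \/ T j <= S i,
      ((\sum_(i < n) (T i - S i))%:E <= mu (U `&` `]s, t]))%E &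
      f s - f t <= k * (t - s) + \sum_(i < n) `|f (T i) - f (S i)|].
have [n [S [T [ST disj STU fab]]]] : P a b.
  apply: cousin => // [r s t rs st|x].
    move=> [n1 [S1 [T1 [ST1 disj1 U1 f1]]]] [n2 [S2 [T2 [ST2 disj2 U2 f2]]]].
    (* Gluing at [s] concatenates the two families of intervals. *)
    pose cat (u v : nat -> R) i := if (i < n1)%N then u i else v (i - n1)%N.
    have catE (g : R -> R -> R) : \sum_(i < n1 + n2) g (cat T1 T2 i) (cat S1 S2 i) =
        \sum_(i < n1) g (T1 i) (S1 i) + \sum_(i < n2) g (T2 i) (S2 i).
      rewrite big_split_ord/=; congr (_ + _); apply: eq_bigr => i _.
        by rewrite /cat/= ltn_ord.
      by rewrite /cat/= ltnNge leq_addr/= addKn.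
    have ltn_cat i : (i < n1 + n2)%N -> (n1 <= i)%N -> (i - n1 < n2)%N.
      by move=> ? ?; rewrite ltn_subLR.
    exists (n1 + n2)%N, (cat S1 S2), (cat T1 T2); split.
    - move=> i ilt; rewrite /cat; case: ltnP => in1.
        by have [? ? ?] := ST1 _ in1; split => //; lra.
      by have [? ? ?] := ST2 _ (ltn_cat _ ilt in1); split => //; lra.
    - move=> i j ilt jlt ij; rewrite /cat; case: ltnP => in1; case: ltnP => jn1.
      + exact: disj1.
      + have [_ _ ?] := ST1 _ in1.
        by have [? _ _] := ST2 _ (ltn_cat _ jlt jn1); left; lra.
      + have [_ _ ?] := ST1 _ jn1.
        by have [? _ _] := ST2 _ (ltn_cat _ ilt in1); right; lra.
      + apply: disj2; rewrite ?ltn_cat// => ijE; apply: ij.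
        by rewrite -(subnK in1) -(subnK jn1) ijE.
    - rewrite (catE (fun u v => u - v)) EFinD.
      apply: le_trans (leeD U1 U2) _.
      (* The half-open intervals ]r, s] and ]s, t] are disjoint, so their measures inside [U]
         add. *)
      rewrite -measureU//; last 3 first.
      + by apply: measurableI => //; exact: measurable_itv.
      + by apply: measurableI => //; exact: measurable_itv.
      + apply/seteqP; split => // x [[_ +] [_]].
        rewrite /= !in_itv/= => /andP[_ xs] /andP[sx _].
        by have := lt_le_trans sx xs; rewrite ltxx.
      rewrite -setIUr; apply: le_measure; rewrite ?inE.
      + by apply: measurableI => //; apply: measurableU; exact: measurable_itv.
      + by apply: measurableI => //; exact: measurable_itv.
      + apply: setIS => x [|] /=; rewrite !in_itv/= => /andP[lx xu].
          by rewrite lx (le_trans xu st).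
        by rewrite xu (le_lt_trans rs lx).
    - rewrite (catE (fun u v => `|f u - f v|)); lra.
  (* A tag in [U] contributes the single interval [s, t], small enough to lie in [U]. A tag outside
     [U] is outside [B], so the derivative estimate holds there and the family is empty. *)
  have [Ux|Ux] := pselect (U x).
    have /nbhs_ballP[r /= r0 rU] : nbhs x U by apply: open_nbhs_nbhs.
    exists r => // s t xs sx xt tx; exists 1%N, (fun=> s), (fun=> t); split.
    - by move=> _ _; split => //; lra.
    - by move=> [|//] [|].
    - rewrite big_ord1 (_ : U `&` _ = `]s, t]%classic); last first.
        apply: setIidr => y /=; rewrite in_itv/= => /andP[sy yt]; apply: rU.
        by rewrite /ball/= ltr_norml; apply/andP; split; lra.
      rewrite lebesgue_measure_itv/= lte_fin.
      have [//|ts] := ltP s t.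
      by rewrite lee_fin; lra.
    - rewrite big_ord1; have := ler_norm (f s - f t); rewrite distrC.
      have : 0 <= k * (t - s) by apply: mulr_ge0; [exact: ltW|lra].
      lra.
  have [df df0 fx] : exists2 df : R, 0 <= df & is_derive x (1 : R) f df.
    by apply: contrapT => nfx; apply/Ux/BU/fB.
  have [r r0 fr] := derive_ge0_local fx df0 k0.
  exists r => // s t xs sx xt tx; exists 0%N, (fun=> s), (fun=> t).
  by split => //; rewrite big_ord0 ?measure_ge0// addr0 fr.
have : \sum_(i < n) `|f (T i) - f (S i)| < e / 2.
  apply: fd => //; rewrite -lte_fin; apply: le_lt_trans STU _.
  by apply: le_lt_trans Ud; rewrite le_measure ?inE//; apply: measurableI => //; exact: measurable_itv.
have : k * (b - a) <= e / 2.
  by rewrite /k mulrAC ler_pdivrMr; lra.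
lra.
Qed.

Lemma AC_loc_constant f : AC_loc_R f ->
  {ae mu, forall x, is_derive x (1 : R) f 0} -> forall x y, f x = f y.
Proof.
move=> fac f'0.
have fle := AC_loc_nondecreasing fac.
have fge := AC_loc_nondecreasing (AC_locN fac).
suff fE x y : x <= y -> f x = f y.
  by move=> x y; have [/fE //|/ltW/fE ->] := leP x y.
move=> xy; apply/eqP; rewrite eq_le fle//=; last first.
  by move: f'0; apply: filterS => u ?; exists 0.
rewrite -lerN2; apply: fge => //.
by move: f'0; apply: filterS => u ?; exists 0 => //; rewrite -oppr0; exact: is_deriveN.
Qed.

(** Almost everywhere the derivative of f(x)e^{-kx} is e^{-kx}(f' - kf) <= 0. Neither [f] nor [k]
    has a prescribed sign, which permits the backward use with -f and -k. *)
Lemma AC_loc_gronwall f f' (k x y : R) : AC_loc_R f ->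
  {ae mu, forall x, is_derive x (1 : R) f (f' x)} ->
  (forall x, f' x <= k * f x) ->
  x <= y -> f y * expR (- k * y) <= f x * expR (- k * x).
Proof.
move=> fac ff' f'k xy; rewrite -lerN2.
apply: (@AC_loc_nondecreasing (fun x => - (f x * expR (- k * x)))) xy.
  by apply/AC_locN/AC_locM => //; exact: AC_loc_expR.
move: ff'; apply: filterS => u fu.
exists (- (f u * (expR (- k * u) * - k) + expR (- k * u) * f' u)).
  have -> : - (f u * (expR (- k * u) * - k) + expR (- k * u) * f' u) =
            expR (- k * u) * (k * f u - f' u) by ring.
  by rewrite mulr_ge0 ?expR_ge0// subr_ge0.
have dk : is_derive u (1 : R) (fun x : R => - k * x) (- k).
  have := is_deriveZ (- k) (@is_derive_id R R u 1).
  by rewrite -[_ *: _]/(_ * _) mulr1.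
have dexp := is_derive1_comp (is_derive_expR (- k * u)) dk.
exact: is_deriveN (is_deriveM fu dexp).
Qed.

End Monotonicity.

(** * Complex-valued functions *)
Section ComplexValued.
Context {R : realType}.
Local Notation C := R[i].
Local Notation mu := (@lebesgue_measure R).

(** * Real and imaginary parts, and the norm on C^2 *)

Lemma cReM (x y : C) : cRe (x * y) = cRe x * cRe y - cIm x * cIm y.
Proof. by case: x y => [a b] [c d]. Qed.

Lemma cImM (x y : C) : cIm (x * y) = cRe x * cIm y + cIm x * cRe y.
Proof. by case: x y => [a b] [c d]. Qed.

Lemma cReD (x y : C) : cRe (x + y) = cRe x + cRe y.
Proof. by case: x y => [a b] [c d]. Qed.

Lemma cImD (x y : C) : cIm (x + y) = cIm x + cIm y.
Proof. by case: x y => [a b] [c d]. Qed.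

Lemma cReN (x : C) : cRe (- x) = - cRe x.
Proof. by case: x. Qed.

Lemma cImN (x : C) : cIm (- x) = - cIm x.
Proof. by case: x. Qed.

Lemma cReJ (x : C) : cRe (conjc x) = cRe x.
Proof. by case: x. Qed.

Lemma cImJ (x : C) : cIm (conjc x) = - cIm x.
Proof. by case: x. Qed.

Lemma cRe_real (x : R) : cRe x%:C%C = x. Proof. by []. Qed.
Lemma cIm_real (x : R) : cIm x%:C%C = 0. Proof. by []. Qed.
Lemma cRe_i : cRe ('i%C : C) = 0. Proof. by []. Qed.
Lemma cIm_i : cIm ('i%C : C) = 1. Proof. by []. Qed.
Lemma cRe_0 : cRe (0 : C) = 0. Proof. by []. Qed.
Lemma cIm_0 : cIm (0 : C) = 0. Proof. by []. Qed.

(** Together with [complex_ext], these rules turn identities that involve conjugation into real ones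
    within reach of [ring] and [field]. *)
Definition cE := (cReM, cImM, cReD, cImD, cReN, cImN, cReJ, cImJ,
  cRe_real, cIm_real, cRe_i, cIm_i, cRe_0, cIm_0).

Lemma complex_ext (x y : C) : cRe x = cRe y -> cIm x = cIm y -> x = y.
Proof. by case: x y => [a b] [c d] /= -> ->. Qed.

Lemma nsq_ge0 (v : vec) : 0 <= nsq v :> R.
Proof. by rewrite /nsq !addr_ge0 ?sqr_ge0. Qed.

Lemma nsq_eq0 (v : vec) : nsq v = 0 :> R -> v = (0, 0).
Proof.
move=> /eqP; rewrite /nsq !paddr_eq0 ?addr_ge0 ?sqr_ge0// !sqrf_eq0.
by case: v => [[a b] [c d]] /= /andP[/andP[/andP[/eqP-> /eqP->] /eqP->] /eqP->].
Qed.

Lemma nsq_gt0 (v : vec) : v <> (0, 0) -> 0 < nsq v :> R.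
Proof. by move=> v0; rewrite lt0r nsq_ge0 andbT; apply/eqP => /nsq_eq0. Qed.

(** In this form the complex product rule differentiates the squared norm. *)
Lemma nsqE (v : vec) :
  nsq v = cRe (v.1 * conjc v.1 + v.2 * conjc v.2) :> R.
Proof. by rewrite !cE /nsq; ring. Qed.

Lemma nsq_Kv (v : vec) : nsq (Kv v) = nsq v :> R.
Proof. by rewrite /nsq /Kv/= !cE; ring. Qed.

Lemma nsq_vscale (a : R) (v : vec) : nsq (vscale a%:C%C v) = a ^+ 2 * nsq v.
Proof. by rewrite /nsq /vscale/= !cE; ring. Qed.

(** * Differentiation rules for absolutely continuous functions *)

Definition AC_deriv_R (f f' : R -> R) :=
  AC_loc_R f /\ {ae mu, forall x, is_derive x (1 : R) f (f' x)}.

Definition AC_deriv (f f' : R -> C) := AC_loc_C f /\ has_deriv_ae f f'.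

Lemma AC_derivP f f' : AC_deriv f f' <->
  AC_deriv_R (fun x => cRe (f x)) (fun x => cRe (f' x)) /\
  AC_deriv_R (fun x => cIm (f x)) (fun x => cIm (f' x)).
Proof.
split=> [[[rf jf] ff']|[[rf rf'] [jf jf']]].
  by do 2 split => //; move: ff'; apply: filterS => x [].
by split => //; move: rf' jf'; apply: filterS2 => x; split.
Qed.

Lemma AC_deriv_RD f f' g g' : AC_deriv_R f f' -> AC_deriv_R g g' ->
  AC_deriv_R (fun x => f x + g x) (fun x => f' x + g' x).
Proof.
move=> [fac ff'] [gac gg']; split; first exact: AC_locD.
by move: ff' gg'; apply: filterS2 => x; exact: is_deriveD.
Qed.

Lemma AC_deriv_RN f f' : AC_deriv_R f f' ->
  AC_deriv_R (fun x => - f x) (fun x => - f' x).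
Proof.
move=> [fac ff']; split; first exact: AC_locN.
by move: ff'; apply: filterS => x; exact: is_deriveN.
Qed.

Lemma AC_deriv_RM f f' g g' : AC_deriv_R f f' -> AC_deriv_R g g' ->
  AC_deriv_R (fun x => f x * g x) (fun x => f x * g' x + g x * f' x).
Proof.
move=> [fac ff'] [gac gg']; split; first exact: AC_locM.
by move: ff' gg'; apply: filterS2 => x; exact: is_deriveM.
Qed.

Lemma AC_deriv_RV f f' : (forall x, f x != 0) -> AC_deriv_R f f' ->
  AC_deriv_R (fun x => (f x)^-1) (fun x => - (f x ^- 2) * f' x).
Proof.
move=> f0 [fac ff']; split; first exact: AC_locV.
by move: ff'; apply: filterS => x; exact: is_deriveV.
Qed.

Lemma AC_deriv_R_cst (c : R) : AC_deriv_R (fun=> c) (fun=> 0).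
Proof.
split; first exact: AC_loc_cst.
by apply: nearW => x; exact: is_derive_cst.
Qed.

Lemma AC_deriv_R_eq f f' g g' : f =1 g -> f' =1 g' ->
  AC_deriv_R f f' -> AC_deriv_R g g'.
Proof. by move=> /funext -> /funext ->. Qed.

Lemma AC_deriv_eq f f' g' : f' =1 g' -> AC_deriv f f' -> AC_deriv f g'.
Proof. by move=> /funext ->. Qed.

Lemma AC_deriv_cst (c : C) : AC_deriv (fun=> c) (fun=> 0).
Proof. by apply/AC_derivP; split; exact: AC_deriv_R_cst. Qed.

Lemma AC_deriv_real f f' : AC_deriv_R f f' ->
  AC_deriv (fun x => (f x)%:C%C) (fun x => (f' x)%:C%C).
Proof. by move=> ?; apply/AC_derivP; split => //; exact: AC_deriv_R_cst. Qed.

Lemma AC_derivJ f f' : AC_deriv f f' ->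
  AC_deriv (fun x => conjc (f x)) (fun x => conjc (f' x)).
Proof.
move=> /AC_derivP[rf jf]; apply/AC_derivP; split.
  by apply: AC_deriv_R_eq rf => x; rewrite !cE.
by apply: AC_deriv_R_eq (AC_deriv_RN jf) => x; rewrite !cE.
Qed.

Lemma AC_derivN f f' : AC_deriv f f' ->
  AC_deriv (fun x => - f x) (fun x => - f' x).
Proof.
move=> /AC_derivP[rf jf]; apply/AC_derivP; split.
  by apply: AC_deriv_R_eq (AC_deriv_RN rf) => x; rewrite !cE.
by apply: AC_deriv_R_eq (AC_deriv_RN jf) => x; rewrite !cE.
Qed.

Lemma AC_derivD f f' g g' : AC_deriv f f' -> AC_deriv g g' ->
  AC_deriv (fun x => f x + g x) (fun x => f' x + g' x).
Proof.
move=> /AC_derivP[rf jf] /AC_derivP[rg jg]; apply/AC_derivP; split.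
  by apply: AC_deriv_R_eq (AC_deriv_RD rf rg) => x; rewrite !cE.
by apply: AC_deriv_R_eq (AC_deriv_RD jf jg) => x; rewrite !cE.
Qed.

Lemma AC_derivM f f' g g' : AC_deriv f f' -> AC_deriv g g' ->
  AC_deriv (fun x => f x * g x) (fun x => f x * g' x + g x * f' x).
Proof.
move=> /AC_derivP[rf jf] /AC_derivP[rg jg]; apply/AC_derivP; split.
  have := AC_deriv_RD (AC_deriv_RM rf rg) (AC_deriv_RN (AC_deriv_RM jf jg)).
  by apply: AC_deriv_R_eq => x; rewrite !cE; ring.
have := AC_deriv_RD (AC_deriv_RM rf jg) (AC_deriv_RM jf rg).
by apply: AC_deriv_R_eq => x; rewrite !cE; ring.
Qed.

End ComplexValued.

(** * Solutions of M(r) F = z F *)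
Section DiracSystem.
Context {R : realType}.
Local Notation C := R[i].
Local Notation mu := (@lebesgue_measure R).
Implicit Types (r : R -> C) (z : C) (F G : R -> C * C).

(** Nontriviality is left out, unlike for wave functions, so that solutions form a vector space
    containing zero. *)
Definition solution r z F :=
  AC_deriv (fun x => (F x).1) (fun x => - 'i%C * z * (F x).1 + r x * (F x).2) /\
  AC_deriv (fun x => (F x).2) (fun x => 'i%C * z * (F x).2 - conjc (r x) * (F x).1).

Lemma solution_AC_loc r z F : solution r z F -> AC_loc_v F.
Proof. by move=> [[? _] [? _]]. Qed.

Lemma solution_Mrel r z F : solution r z F -> Mrel r F (fun x => vscale z (F x)).
Proof.
move=> sF; split; first exact: solution_AC_loc sF.
have [[_ dF1] [_ dF2]] := sF.
exists (fun x => - 'i%C * z * (F x).1 + r x * (F x).2).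
exists (fun x => 'i%C * z * (F x).2 - conjc (r x) * (F x).1).
split => //; apply: nearW => x; rewrite /vscale.
by congr (_, _); apply: complex_ext; rewrite !cE; ring.
Qed.

Lemma Mrel_solution r z F : Mrel r F (fun x => vscale z (F x)) -> solution r z F.
Proof.
move=> [[AC1 AC2] [d1 [d2 [dF1 dF2 eqF]]]].
(* Multiplication by -i undoes the factor i of M(r) and isolates the derivatives. *)
have iK (x : C) : x = - 'i%C * ('i%C * x) by apply: complex_ext; rewrite !cE; ring.
split; split => //.
  move: dF1 eqF; apply: filterS2 => x; rewrite /vscale => + [zF1 _].
  suff -> : d1 x = - 'i%C * z * (F x).1 + r x * (F x).2 by [].
  by rewrite -mulrA zF1 -iK subrK.
move: dF2 eqF; apply: filterS2 => x; rewrite /vscale => + [_ zF2].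
suff -> : d2 x = 'i%C * z * (F x).2 - conjc (r x) * (F x).1 by [].
rewrite -mulrA zF2 -[d2 x]opprK -[X in _ = X - _]opprK -mulNr -iK; ring.
Qed.

(** The potential enters as 2 Re(r F_2 conj F_1) - 2 Re(conj r F_1 conj F_2); the two arguments are
    conjugate, so the terms cancel. *)
Lemma solution_nsq r z F : solution r z F ->
  AC_deriv_R (fun x => nsq (F x)) (fun x => 2 * cIm z *
    (cRe (F x).1 ^+ 2 + cIm (F x).1 ^+ 2 - (cRe (F x).2 ^+ 2 + cIm (F x).2 ^+ 2))).
Proof.
move=> [F1 F2].
have /AC_derivP[+ _] := AC_derivD (AC_derivM F1 (AC_derivJ F1)) (AC_derivM F2 (AC_derivJ F2)).
by apply: AC_deriv_R_eq => x; rewrite ?nsqE !cE; ring.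
Qed.

Lemma solution_eq0 r z F x0 : solution r z F -> F x0 = (0, 0) ->
  forall x, F x = (0, 0).
Proof.
move=> /solution_nsq[Nac N'] F0 x; apply: nsq_eq0.
have N0 : nsq (F x0) = 0 by rewrite F0 /nsq/=; ring.
apply/eqP; rewrite eq_le nsq_ge0 andbT.
pose D y := 2 * cIm z *
  (cRe (F y).1 ^+ 2 + cIm (F y).1 ^+ 2 - (cRe (F y).2 ^+ 2 + cIm (F y).2 ^+ 2)).
have D_le y : `|D y| <= 2 * `|cIm z| * nsq (F y).
  rewrite /D !normrM normr_nat ler_wpM2l ?mulr_ge0// ler_norml /nsq.
  have := sqr_ge0 (cRe (F y).1); have := sqr_ge0 (cIm (F y).1).
  have := sqr_ge0 (cRe (F y).2); have := sqr_ge0 (cIm (F y).2).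
  by move=> *; apply/andP; split; lra.
have [x0x|/ltW xx0] := leP x0 x.
  have := AC_loc_gronwall (f' := D) (k := 2 * `|cIm z|) Nac N' _ x0x.
  rewrite N0 mul0r pmulr_lle0 ?expR_gt0//; apply => y.
  exact: le_trans (ler_norm _) (D_le y).
(* To the left of [x0] the estimate is applied to -N with rate -2|Im z|. *)
have [Mac M'] := AC_deriv_RN (conj Nac N').
have := AC_loc_gronwall (f' := fun y => - D y) (k := - (2 * `|cIm z|)) Mac M' _ xx0.
rewrite N0 oppr0 mul0r mulNr oppr_ge0 pmulr_lle0 ?expR_gt0//; apply => y.
by rewrite mulrNN; apply: le_trans (D_le y); rewrite -normrN ler_norm.
Qed.

Lemma solution_lincomb r z F G c : solution r z F -> solution r z G ->
  solution r z (fun x => ((G x).1 - c * (F x).1, (G x).2 - c * (F x).2)).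
Proof.
move=> [F1 F2] [G1 G2]; split.
  have := AC_derivD G1 (AC_derivN (AC_derivM (AC_deriv_cst c) F1)).
  by apply: AC_deriv_eq => x /=; ring.
have := AC_derivD G2 (AC_derivN (AC_derivM (AC_deriv_cst c) F2)).
by apply: AC_deriv_eq => x /=; ring.
Qed.

(** Conjugation exchanges the two equations and turns z into its conjugate, with the same potential;
    this transfers the result at [z1] to its conjugate. *)
Lemma solution_Kv r z F : solution r z F -> solution r (conjc z) (fun x => Kv (F x)).
Proof.
move=> [F1 F2]; split.
  have := AC_derivJ F2; apply: AC_deriv_eq => x /=.
  by apply: complex_ext; rewrite !cE; ring.
have := AC_derivN (AC_derivJ F1); apply: AC_deriv_eq => x /=.
by apply: complex_ext; rewrite !cE; ring.
Qed.

(** The coefficient matrix has trace -iz + iz = 0 (Liouville's formula). *)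
Lemma wronskian_constant r z F G : solution r z F -> solution r z G ->
  forall x y, (F x).1 * (G x).2 - (F x).2 * (G x).1 =
              (F y).1 * (G y).2 - (F y).2 * (G y).1.
Proof.
move=> [F1 F2] [G1 G2] x y.
have /AC_derivP[[Wr Wr'] [Wi Wi']] :
    AC_deriv (fun x => (F x).1 * (G x).2 - (F x).2 * (G x).1) (fun=> 0).
  have := AC_derivD (AC_derivM F1 G2) (AC_derivN (AC_derivM F2 G1)).
  by apply: AC_deriv_eq => u; ring.
by apply: complex_ext; [exact: (AC_loc_constant Wr Wr')|exact: (AC_loc_constant Wi Wi')].
Qed.

End DiracSystem.

(** * Eigenfunctions *)
Section Eigenvalues.
Context {R : realType}.
Local Notation C := R[i].
Local Notation mu := (@lebesgue_measure R).
Implicit Types (r : R -> C) (z : C) (F G : R -> C * C).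

(** * Square integrability and Wronskians *)

Lemma lebesgue_measure_setT : mu [set: R] = +oo%E.
Proof. by have := @lebesgue_measure_itv R `]-oo, +oo[; rewrite set_itvE. Qed.

Lemma AC_loc_measurable (f : R -> R) : AC_loc_R f -> measurable_fun setT f.
Proof. by move=> fac; apply: continuous_measurable_fun; exact: AC_loc_continuous. Qed.

Lemma AC_loc_sqr (f : R -> R) : AC_loc_R f -> AC_loc_R (fun x => f x ^+ 2).
Proof. by move=> fac; exact: (AC_locM fac fac). Qed.

Lemma AC_loc_nsq F : AC_loc_v F -> AC_loc_R (fun x => nsq (F x)).
Proof.
by move=> [[? ?] [? ?]]; rewrite /nsq; do 3?apply: AC_locD; exact: AC_loc_sqr.
Qed.

(** Absolute continuity supplies the measurability, so only finiteness of the integral of ||F||^2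
    remains. *)
Lemma L2v_AC F : AC_loc_v F ->
  L2v F <-> (\int[mu]_x (nsq (F x))%:E < +oo)%E.
Proof.
move=> Fac; have /AC_loc_measurable mF := AC_loc_nsq Fac.
have [[F1r F1i] [F2r F2i]] := Fac.
have sq_meas (f g : R -> R) : AC_loc_R f -> AC_loc_R g ->
    measurable_fun setT (fun x => (f x ^+ 2 + g x ^+ 2)%:E).
  move=> ? ?; apply/measurable_EFinP; apply: AC_loc_measurable.
  by apply: AC_locD; exact: AC_loc_sqr.
have sq_ge0 (a b : R) : (0 <= (a ^+ 2 + b ^+ 2)%:E)%E.
  by rewrite lee_fin addr_ge0 ?sqr_ge0.
have m1 := sq_meas _ _ F1r F1i; have m2 := sq_meas _ _ F2r F2i.
have sumE : (\int[mu]_x (nsq (F x))%:E =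
    \int[mu]_x (cRe (F x).1 ^+ 2 + cIm (F x).1 ^+ 2)%:E +
    \int[mu]_x (cRe (F x).2 ^+ 2 + cIm (F x).2 ^+ 2)%:E)%E.
  rewrite -ge0_integralD//.
  apply: eq_integral => x _.
  by rewrite -EFinD /nsq addrA.
have int_ge0 (f g : R -> R) : (0 <= \int[mu]_x (f x ^+ 2 + g x ^+ 2)%:E)%E.
  by apply: integral_ge0 => x _.
rewrite sumE; split=> [[[_ _ i1] [_ _ i2]]|i12]; first exact: lte_add_pinfty.
split; split; try exact: AC_loc_measurable.
  by apply: le_lt_trans i12; rewrite leeDl// int_ge0.
by apply: le_lt_trans i12; rewrite leeDr// int_ge0.
Qed.

(** Needed for the domain condition: the image M(r)F = zF must be square integrable too. *)
Lemma L2v_vscale z F : AC_loc_v F -> L2v F -> L2v (fun x => vscale z (F x)).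
Proof.
move=> Fac; have [[F1r F1i] [F2r F2i]] := Fac.
have zac (f : R -> C) : AC_loc_C f -> AC_loc_C (fun x => z * f x).
  move=> [fr fi]; split.
    have := AC_locD (AC_locM (AC_loc_cst (cRe z)) fr)
                    (AC_locN (AC_locM (AC_loc_cst (cIm z)) fi)).
    by congr AC_loc_R; apply/funext => x; rewrite cReM.
  have := AC_locD (AC_locM (AC_loc_cst (cRe z)) fi)
                  (AC_locM (AC_loc_cst (cIm z)) fr).
  by congr AC_loc_R; apply/funext => x; rewrite cImM.
have zFac : AC_loc_v (fun x => vscale z (F x)) by split; exact: zac.
move=> /(L2v_AC Fac) iF; apply/(L2v_AC zFac).
have -> : (\int[mu]_x (nsq (vscale z (F x)))%:E =
    \int[mu]_x ((cRe z ^+ 2 + cIm z ^+ 2)%:E * (nsq (F x))%:E))%E.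
  by apply: eq_integral => x _; rewrite -EFinM /nsq/= !cE; congr _%:E; ring.
rewrite ge0_integralZl//=.
- apply: lte_mul_pinfty => //; rewrite lee_fin addr_ge0 ?sqr_ge0//.
- by apply/measurable_EFinP; apply: AC_loc_measurable; exact: AC_loc_nsq.
- by move=> x _; rewrite lee_fin nsq_ge0.
- by rewrite lee_fin addr_ge0 ?sqr_ge0.
Qed.

(** Each of the products of real coordinates is bounded by |ab| <= (a^2 + b^2)/2. For
    square-integrable solutions the right side is integrable. *)
Lemma norm_wronskian_le (v w : vec) :
  `|cRe (v.1 * w.2 - v.2 * w.1)| <= nsq v + nsq w :> R /\
  `|cIm (v.1 * w.2 - v.2 * w.1)| <= nsq v + nsq w :> R.
Proof.
have AG (a b : R) : `|a * b| <= (a ^+ 2 + b ^+ 2) / 2.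
  have := sqr_ge0 (a - b); have := sqr_ge0 (a + b); rewrite sqrrB sqrrD => *.
  by rewrite ler_norml; apply/andP; split; lra.
have := (nsq_ge0 v, nsq_ge0 w); rewrite !cE /nsq => -[? ?].
split; (apply: le_trans (ler_normD _ _) _; rewrite ?normrN;
  apply: le_trans (lerD (ler_normD _ _) (ler_normD _ _)) _; rewrite ?normrN).
  have := AG (cRe v.1) (cRe w.2); have := AG (cIm v.1) (cIm w.2).
  by have := AG (cRe v.2) (cRe w.1); have := AG (cIm v.2) (cIm w.1); lra.
have := AG (cRe v.1) (cIm w.2); have := AG (cIm v.1) (cRe w.2).
by have := AG (cRe v.2) (cIm w.1); have := AG (cIm v.2) (cRe w.1); lra.
Qed.

(** The line has infinite measure, so a nonzero constant has no integrable majorant. *)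
Lemma integrable_bound_eq0 (g : R -> R) (k : R) :
  measurable_fun setT g -> (\int[mu]_x (g x)%:E < +oo)%E ->
  (forall x, `|k| <= g x) -> k = 0.
Proof.
move=> mg ig kg; have [//|k0] := eqVneq k 0.
suff : (+oo <= \int[mu]_x (g x)%:E)%E by rewrite leNgt ig.
have kE : (\int[mu]_x (`|k|%:E) = +oo)%E.
  rewrite (_ : (fun _ => _) = cst `|k|%:E)// integral_cst//= lebesgue_measure_setT.
  by rewrite gt0_muley// lte_fin normr_gt0.
rewrite -kE; apply: ge0_le_integral => //.
- exact/measurable_EFinP.
- by move=> x _; rewrite lee_fin.
Qed.

Lemma wronskian_eq0 r z F G : solution r z F -> solution r z G ->
  L2v F -> L2v G -> forall x, (F x).1 * (G x).2 = (F x).2 * (G x).1.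
Proof.
move=> sF sG L2F L2G x; apply/eqP; rewrite -subr_eq0; apply/eqP.
have Fac := solution_AC_loc sF; have Gac := solution_AC_loc sG.
have mF := AC_loc_measurable (AC_loc_nsq Fac).
have mG := AC_loc_measurable (AC_loc_nsq Gac).
have iFG : (\int[mu]_x (nsq (F x) + nsq (G x))%:E < +oo)%E.
  under eq_integral do rewrite EFinD.
  rewrite ge0_integralD//.
  - by apply: lte_add_pinfty; [exact/(L2v_AC Fac)|exact/(L2v_AC Gac)].
  - by move=> y _; rewrite lee_fin nsq_ge0.
  - exact/measurable_EFinP.
  - by move=> y _; rewrite lee_fin nsq_ge0.
  - exact/measurable_EFinP.
have bnd y := norm_wronskian_le (F y) (G y).
apply: complex_ext; apply: integrable_bound_eq0 (measurable_funD mF mG) iFG _ => y.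
  (* The value at the fixed [x] is also the value at every [y], hence is bounded by the integrable
     function of [y]. *)
  by rewrite (wronskian_constant sF sG x y); have [] := bnd y.
by rewrite (wronskian_constant sF sG x y); have [] := bnd y.
Qed.

Lemma solution_simple_eigen r z F : solution r z F -> L2v F ->
  (forall x, F x <> (0, 0)) -> simple_eigen r z F.
Proof.
move=> sF L2F F0; have Fac := solution_AC_loc sF.
have MF := solution_Mrel sF; split => //.
- by split => //; exists (fun x => vscale z (F x)); split => //; exact: L2v_vscale.
(* As [F] vanishes nowhere, the null set would be the whole line. *)
- move=> F0ae; have : ({ae mu, forall x : R, False}).
    by move: F0ae; apply: filterS => x /F0.
  move=> [A [mA A0 FA]].
  have AT : A = setT.
    by apply/seteqP; split => // y _; exact: FA.
  by move: A0; rewrite AT lebesgue_measure_setT.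
move=> G [L2G Gac _] /Mrel_solution sG.
(* The base point 0 is arbitrary. There the vanishing Wronskian makes G a multiple of the nonzero
   vector F; [c] is the quotient of components at which F is nonzero. *)
have W0 := wronskian_eq0 sF sG L2F L2G 0.
have [c Gc] : exists c, G 0 = vscale c (F 0).
  rewrite /vscale; move: W0 (F0 0); case: (F 0) (G 0) => [f1 f2] [g1 g2] /=.
  have [->|f10] := eqVneq f1 0.
    rewrite mul0r => /esym/eqP; rewrite mulf_eq0 => /orP[/eqP-> //|/eqP->] f12.
    have f20 : f2 != 0 by apply/eqP => f20; apply: f12; rewrite f20.
    by exists (g2 / f2); rewrite mulr0 divfK.
  move=> W0 _; exists (g1 / f1); rewrite divfK//; congr (_, _).
  by apply: (mulfI f10); rewrite W0; field.
(* G - cF is a solution with a zero, so it vanishes identically. *)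
have H0 : forall x, ((G x).1 - c * (F x).1, (G x).2 - c * (F x).2) = (0, 0).
  apply: (solution_eq0 (x0 := 0) (solution_lincomb c sF sG)).
  by rewrite Gc /= !subrr.
exists c; apply: nearW => x; have [] := H0 x.
by move=> /eqP; rewrite subr_eq0 => /eqP G1 /eqP; rewrite subr_eq0 => /eqP G2;
  rewrite /vscale -G1 -G2; case: (G x).
Qed.

(** * Wave functions and the transformed solution *)

Lemma wave_function_solution r z F : wave_function r z F -> solution r z F.
Proof. by move=> [[? ?] _ ? ?]. Qed.

Lemma wave_function_neq0 r z F : wave_function r z F -> forall x, F x <> (0, 0).
Proof.
move=> wF x Fx0; have [_ [y Fy0] _ _] := wF; apply: Fy0.
exact: solution_eq0 (wave_function_solution wF) Fx0 y.
Qed.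

(** K Psi solves the old system at conj z. In the first component, passing to z costs -2b and the
    factor 1/N adds -N'/N; as N = |psi_1|^2 + |psi_2|^2 the sum is -4b|psi_1|^2/N, exactly what the
    correction of the potential contributes. The second component has |psi_2|^2 instead. *)
Lemma solution_Phi1 r z F : solution r z F -> (forall x, F x <> (0, 0)) ->
  solution (q1 r z F) z (Phi1 z F).
Proof.
move=> sF F0; have [F1 F2] := sF.
have N0 x : nsq (F x) != 0 by rewrite gt_eqF// nsq_gt0.
have NV := AC_deriv_RV N0 (solution_nsq sF).
have := AC_deriv_real (AC_deriv_RM (AC_deriv_R_cst (cIm z)) NV) => bN.
split.
  have := AC_derivM bN (AC_derivJ F2); apply: AC_deriv_eq => x; have := N0 x.
  rewrite /nsq /Phi1 /q1 /Kv /vscale /nsq /= => ?.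
  by apply: complex_ext; rewrite !cE; field.
have := AC_derivM bN (AC_derivN (AC_derivJ F1)); apply: AC_deriv_eq => x; have := N0 x.
rewrite /nsq /Phi1 /q1 /Kv /vscale /nsq /= => ?.
by apply: complex_ext; rewrite !cE; field.
Qed.

End Eigenvalues.

(** * The two eigenvalues of the transformed operator *)

Unset Implicit Arguments.
Set Strict Implicit.

Theorem theorem4p5 (R : realType) (q : R -> R[i]) (z1 : R[i]) (Psi : R -> R[i] * R[i]) :
  L1loc_C q ->
  cIm z1 != 0 ->
  wave_function q z1 Psi ->
  (\int[@lebesgue_measure R]_x ((nsq (Psi x))^-1)%:E < +oo)%E ->
  [/\ simple_eigen (q1 q z1 Psi) z1 (Phi1 z1 Psi),
      simple_eigen (q1 q z1 Psi) (conjc z1) (fun x => Kv (Phi1 z1 Psi x)) &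
      forall x, Kv (Phi1 z1 Psi x) = vscale ((- (cIm z1 / nsq (Psi x)))%:C)%C (Psi x)].
Proof.
move=> _ z10 wPsi iPsi.
have sPsi := wave_function_solution wPsi; have Psi0 := wave_function_neq0 wPsi.
have N0 x : 0 < nsq (Psi x) by exact: nsq_gt0.
have sPhi := solution_Phi1 sPsi Psi0; have sKPhi := solution_Kv sPhi.
(* K preserves the norm, so ||Phi||^2 = b^2/N: the integrability of 1/N is the square integrability
   of Phi. *)
have nsqPhi x : nsq (Phi1 z1 Psi x) = cIm z1 ^+ 2 * (nsq (Psi x))^-1.
  by rewrite /Phi1 nsq_vscale nsq_Kv; field; rewrite gt_eqF.
have neq0 (v : R[i] * R[i]) : 0 < nsq v -> v <> (0, 0).
  by move=> + v0; rewrite v0 /nsq/= => /[dup]; lra.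
have nsqPhi_gt0 x : 0 < nsq (Phi1 z1 Psi x).
  by rewrite nsqPhi mulr_gt0 ?invr_gt0// exprn_even_gt0.
have iPhi : (\int[@lebesgue_measure R]_x (nsq (Phi1 z1 Psi x))%:E < +oo)%E.
  under eq_integral do rewrite nsqPhi EFinM.
  rewrite ge0_integralZl//=.
  - by apply: lte_mul_pinfty => //; rewrite lee_fin sqr_ge0.
  - apply/measurable_EFinP; apply: AC_loc_measurable; apply: AC_locV => [x|].
      by rewrite gt_eqF.
    by apply: AC_loc_nsq; exact: solution_AC_loc sPsi.
  - by move=> x _; rewrite lee_fin invr_ge0 ltW.
  - by rewrite lee_fin sqr_ge0.
split.
- apply: solution_simple_eigen => // [|x]; last exact: neq0.
  exact/(L2v_AC (solution_AC_loc sPhi)).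
- apply: solution_simple_eigen => // [|x]; last by apply: neq0; rewrite nsq_Kv.
  apply/(L2v_AC (solution_AC_loc sKPhi)).
  by under eq_integral do rewrite nsq_Kv.
(* K is antilinear with K^2 = -1, and the scalar b/N is real. *)
move=> x; rewrite /Phi1 /Kv /vscale/=.
by congr (_, _); apply: complex_ext; rewrite !cE; ring.
Qed.
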